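(* Every wild acyclic quiver $Q$ has quiver Grassmannians with singularities, i.e. there exist a finite-dimensional representation $X$ of $Q$ over $\mathbb{C}$ and a dimension vector $\underline{e}$ such that $\mathrm{Gr}_{\underline{e}}(X)$ is singular.
   Context: The quiver Grassmannian $\mathrm{Gr}_{\underline{e}}(X)$ is the projective complex variety of subrepresentations of $X$ of dimension vector $\underline{e}$, a closed subset of $\prod_{p\in Q_0}\mathrm{Gr}(\underline{e}_p,X_p)$, considered as a (reduced) variety. A connected acyclic quiver is wild if and only if its underlying graph is neither a Dynkin diagram ($A$, $D$, $E$) nor an extended Dynkin diagram ($\widetilde A$, $\widetilde D$, $\widetilde E$). *)

(* Defs.v *)
From HB Require Import structures.
From mathcomp Require Import all_boot all_order all_algebra.
From mathcomp Require Import classical_sets reals complex.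
From mathcomp Require Import mpoly.

Set Implicit Arguments.
Unset Strict Implicit.
Unset Printing Implicit Defensive.

Import GRing.Theory.

Local Open Scope classical_set_scope.
Local Open Scope ring_scope.

(** * Quivers *)

Record quiver := Quiver {
  vertex : finType;
  arrow : finType;
  src : arrow -> vertex;
  tgt : arrow -> vertex
}.

Section Quivers.
Variable Q : quiver.

Definition adj : rel (vertex Q) :=
  fun p q => [exists a : arrow Q, (src a == p) && (tgt a == q)].

(* [cycle] accepts a loop ([:: p] with [adj p p]) and the empty sequence. *)
Definition acyclic : Prop := forall c : seq (vertex Q), cycle adj c -> c = [::].

Definition component (p : vertex Q) : {set vertex Q} :=
  [set q | connect (fun u v => adj u v || adj v u) p q]%SET.

Definition nedges (p q : vertex Q) : nat :=
  #|[set a : arrow Q | (src a == p) && (tgt a == q)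
                    || (src a == q) && (tgt a == p)]%SET|.

(* A multigraph on the vertices 0, ..., n-1 is given by its list of edges, each
   edge being listed once, in either order. *)
Definition has_shape (C : {set vertex Q}) (n : nat) (E : seq (nat * nat)) : Prop :=
  exists f : 'I_n -> vertex Q,
    [/\ injective f, C = [set f i | i : 'I_n]%SET &
        forall i j : 'I_n, nedges (f i) (f j) =
          count (fun e => (e == (i : nat, j : nat)) || (e == (j : nat, i : nat))) E].

End Quivers.

(* The path 0 - 1 - ... - m. *)
Definition path_edges (m : nat) : seq (nat * nat) :=
  [seq (i, i.+1) | i <- iota 0 m].

Inductive dynkin : nat -> seq (nat * nat) -> Prop :=
| DynkinA n of (1 <= n)%N : dynkin n (path_edges n.-1)
| DynkinD n of (4 <= n)%N : dynkin n ((n - 3, n - 1)%N :: path_edges (n - 2))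
| DynkinE n of (6 <= n <= 8)%N : dynkin n ((2, n - 1)%N :: path_edges (n - 2)).

(* The extended diagram with index n has n + 1 vertices; for n = 1 the first
   case is the Kronecker graph, with its two edges (0, 1) and (1, 0). *)
Inductive extended_dynkin : nat -> seq (nat * nat) -> Prop :=
| ExtDynkinA n of (1 <= n)%N : extended_dynkin n.+1 ((n, 0)%N :: path_edges n)
| ExtDynkinD n of (4 <= n)%N :
    extended_dynkin n.+1 [:: (n - 3, n - 1)%N, (1, n)%N & path_edges (n - 2)]
| ExtDynkinE6 : extended_dynkin 7 [:: (2, 5)%N, (5, 6)%N & path_edges 4]
| ExtDynkinE7 : extended_dynkin 8 ((3, 7)%N :: path_edges 6)
| ExtDynkinE8 : extended_dynkin 9 ((2, 8)%N :: path_edges 7).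

(* For connected Q this says that the underlying graph of Q is neither a Dynkin
   nor an extended Dynkin diagram; in general Q is wild as soon as one of its
   connected components is. *)
Definition wild (Q : quiver) : Prop :=
  exists p : vertex Q, forall n E, has_shape (component p) n E ->
    ~ dynkin n E /\ ~ extended_dynkin n E.

(** * Affine algebraic sets *)

Section Affine.
Variables (K : fieldType) (n : nat).
Implicit Types (Z A B : set 'rV[K]_n) (x v : 'rV[K]_n) (f : {mpoly K[n]}).

Definition vanishes_on f Z : Prop := forall x, Z x -> f.@[x 0] = 0.

Definition zariski_closed Z : Prop :=
  exists S : set {mpoly K[n]}, Z = [set x | forall f, S f -> f.@[x 0] = 0].

Definition irreducible_closed Z : Prop :=
  [/\ zariski_closed Z, Z !=set0 &
      forall A B, zariski_closed A -> zariski_closed B ->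
        Z `<=` A `|` B -> Z `<=` A \/ Z `<=` B].

(* Chains F 0 < ... < F d of irreducible closed subsets of Z containing x. *)
Definition has_chain Z x (d : nat) : Prop :=
  exists F : nat -> set 'rV[K]_n,
    (forall i, (i <= d)%N -> [/\ irreducible_closed (F i), F i x & F i `<=` Z]) /\
    (forall i, (i < d)%N -> F i `<` F i.+1).

Definition local_dim Z x (d : nat) : Prop :=
  has_chain Z x d /\ forall d', has_chain Z x d' -> (d' <= d)%N.

(* All polynomials vanishing on Z are used, not just defining equations: Z
   carries its reduced structure. *)
Definition tangent Z x v : Prop :=
  forall f, vanishes_on f Z -> \sum_(i < n) (f^`M(i)).@[x 0] * v 0 i = 0.

Definition smooth_at Z x : Prop :=
  exists T : {vspace 'rV[K]_n},
    (forall v, v \in T <-> tangent Z x v) /\ local_dim Z x (\dim T).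

End Affine.

(** * Representations and quiver Grassmannians *)

Record representation (K : fieldType) (Q : quiver) := Representation {
  rspace : vertex Q -> vectType K;
  rmap : forall a : arrow Q, 'Hom(rspace (src a), rspace (tgt a))
}.

Section QuiverGrassmannian.
Variables (K : fieldType) (Q : quiver) (X : representation K Q).
Variable e : vertex Q -> nat.

Definition quiver_grassmannian : set (forall p, {vspace rspace X p}) :=
  [set U | (forall p, \dim (U p) = e p) /\
           (forall a, (rmap X a @: U (src a) <= U (tgt a))%VS)].

Definition codimv (p : vertex Q) : nat := (\dim {: rspace X p} - e p)%N.

(* An affine chart of the product of the Grassmannians Gr(e p, X p) is given by
   bases (a_i, b_j) of the spaces X p: its points are the families of subspaces
   complementary to the spans of the b_j, and the coordinates y_(p, i, j) stand
   for the subspaces spanned by the vectors a_i + \sum_j y_(p, i, j) b_j. *)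
Record chart := Chart {
  chart_sub : forall p, (e p).-tuple (rspace X p);
  chart_compl : forall p, (codimv p).-tuple (rspace X p);
  chart_free : forall p, free (chart_sub p ++ chart_compl p)
}.

Definition coord_idx (p : vertex Q) : finType := ('I_(e p) * 'I_(codimv p))%type.
Definition coords : finType := {p : vertex Q & coord_idx p}.

Definition chart_vector (c : chart) (y : 'rV[K]_#|coords|) (p : vertex Q)
    (i : 'I_(e p)) : rspace X p :=
  tnth (chart_sub c p) i +
  \sum_(j < codimv p)
    y 0 (enum_rank (Tagged coord_idx (i, j) : coords)) *: tnth (chart_compl c p) j.

Definition chart_point (c : chart) (y : 'rV[K]_#|coords|) (p : vertex Q) :
    {vspace rspace X p} :=
  <<[seq chart_vector c y i | i : 'I_(e p)]>>%VS.

Definition in_chart (c : chart) : set 'rV[K]_#|coords| :=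
  [set y | quiver_grassmannian (chart_point c y)].

(* The charts cover the product of Grassmannians by affine open sets, and
   smoothness at a point can be tested in any chart containing it. *)
Definition singular_grassmannian : Prop :=
  exists (c : chart) (y : 'rV[K]_#|coords|),
    in_chart c y /\ ~ smooth_at (in_chart c) y.

End QuiverGrassmannian.

(* Main.v *)
Require Import Defs.
From mathcomp Require Import all_boot all_order all_algebra.
From mathcomp Require Import boolp classical_sets reals complex mpoly.

(** A wild quiver has an arrow: the component of a vertex without arrows is a
single point, which is the Dynkin diagram A_1.  In an acyclic quiver an arrow a
joins two different vertices, and one such arrow already produces a node on a
quiver Grassmannian.

Put K^2 with basis (e_0, e_1) at every vertex, let a act by the nilpotent map N
with N e_0 = 0 and N e_1 = e_0, let all other arrows act by 0, and ask for lines
at the two ends of a and for the zero subspace elsewhere.  Near the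
subrepresentation whose two lines are spanned by e_0, the lines are spanned by
e_0 + s e_1 at the source and e_0 + t e_1 at the target.  Since
N (e_0 + s e_1) = s e_0, the only condition is s t = 0 ([in_end_chart]): the
chart is the union of the two coordinate axes of a plane.

This cross is singular at the origin ([cross_not_smooth]).  A polynomial that
vanishes on both axes has no linear part ([pderiv_eq0]), so the tangent space is
the whole plane.  The local dimension is 1: an irreducible closed subset of the
cross lies on one axis, and an irreducible closed proper subset of that set
which contains the origin is reduced to it
([proper_irreducible_subset_axis]), so no chain has length 2. *)

Set Implicit Arguments.
Unset Strict Implicit.
Unset Printing Implicit Defensive.

Import GRing.Theory Num.Theory.

Local Open Scope classical_set_scope.
Local Open Scope ring_scope.

(** * Polynomials on a coordinate axis *)

Lemma poly_eq0_everywhere (K : numDomainType) (p : {poly K}) :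
  (forall t, p.[t] = 0) -> p = 0.
Proof.
move=> p0; apply/eqP; apply: contraT => p_neq0.
have := @max_poly_roots _ p [seq i%:R | i <- iota 0 (size p)] p_neq0.
rewrite size_map size_iota ltnn => -> //.
  by apply/allP => t _; apply/rootP.
by rewrite map_inj_uniq ?iota_uniq //; exact: mulrIn (oner_neq0 K).
Qed.

Section CoordinateAxis.
Variables (K : numFieldType) (n : nat).
Implicit Types (F Z : set 'rV[K]_n) (f : {mpoly K[n]}) (k : 'I_n).

Definition axis k : set 'rV[K]_n := [set x | forall l, l != k -> x 0 l = 0].

Lemma axis_scale_delta k t : axis k (t *: 'e_k).
Proof. by move=> l lk; rewrite !mxE eqxx (negPf lk) mulr0. Qed.

Lemma axis0 k : axis k 0.
Proof. by move=> l _; rewrite mxE. Qed.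

(** The polynomial of one variable that f induces on the k-th axis. *)
Definition axis_restr k f : {poly K} :=
  mmap (@polyC K) (fun l => if l == k then 'X else 0) f.

Lemma horner_axis_restr k f (x : 'rV[K]_n) :
  axis k x -> (axis_restr k f).[x 0 k] = f.@[x 0].
Proof.
move=> xk; rewrite /axis_restr /mmap /meval horner_sum.
apply: eq_bigr => m _; rewrite hornerM hornerC; congr (_ * _).
rewrite /mmap1 horner_prod; apply: eq_bigr => l _; rewrite horner_exp.
by case: eqP => [->|/eqP lk]; rewrite ?hornerX // horner0 xk.
Qed.

(** Moving along the k-th axis changes only the k-th coordinate, so the other
partial derivatives do not contribute to this chain rule. *)
Lemma deriv_axis_restr k f : (axis_restr k f)^`() = axis_restr k f^`M(k).
Proof.
rewrite /axis_restr [f^`M(k)]/mderiv {1}/mmap !raddf_sum /=.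
apply: eq_bigr => m _.
rewrite mmapZ mmapX /= [_%:R * _]mulrC polyCM -!mulrA deriv_mulC.
congr (_ * _).
rewrite /mmap1 (bigD1 k) //= [in RHS](bigD1 k) //= eqxx.
(* The other variables contribute to each monomial the same constant, 0 or 1,
   before and after differentiation. *)
pose c : K := \prod_(l < n | l != k) 0 ^+ m l.
have const_off (m' : 'X_{1..n}) : (forall l, l != k -> m' l = m l) ->
    \prod_(l < n | l != k) (if l == k then 'X else 0) ^+ m' l = c%:P.
  move=> m'm; rewrite /c rmorph_prod; apply: eq_bigr => l lk.
  by rewrite (negPf lk) m'm // rmorphXn rmorph0.
rewrite !const_off //; last first.
  by move=> l lk; rewrite mnmBE mnm1E eq_sym (negPf lk) subn0.
rewrite mulrC deriv_mulC derivXn mnmBE mnm1E eqxx subn1 mulrnAr.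
by rewrite mulrC polyC_natr mulr_natl.
Qed.

(** In characteristic 0 the axis has infinitely many points, so that a
polynomial which is zero at all of them is formally zero there. *)
Lemma vanishes_on_axis k f : vanishes_on f (axis k) -> axis_restr k f = 0.
Proof.
move=> f0; apply: poly_eq0_everywhere => t.
have := horner_axis_restr f (@axis_scale_delta k t).
by rewrite !mxE !eqxx mulr1 => ->; apply/f0/axis_scale_delta.
Qed.

Lemma pderiv_eq0 k f : vanishes_on f (axis k) ->
  f^`M(k).@[(0 : 'rV[K]_n) 0] = 0.
Proof.
move=> /vanishes_on_axis f0.
rewrite -(horner_axis_restr _ (@axis0 k)) -deriv_axis_restr f0.
by rewrite deriv0 horner0.
Qed.

(** Substituting the k-th coordinate lets equations found on the axis, with one
variable, cut out closed subsets of the whole space. *)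
Definition mpoly_of_poly k (p : {poly K}) : {mpoly K[n]} :=
  \sum_(i < size p) p`_i *: 'X_k ^+ i.

Lemma meval_mpoly_of_poly k p (x : 'rV[K]_n) :
  (mpoly_of_poly k p).@[x 0] = p.[x 0 k].
Proof.
rewrite horner_coef raddf_sum; apply: eq_bigr => i _ /=.
by rewrite mevalZ rmorphXn /= mevalXU.
Qed.

Lemma zariski_closed_zeros f : zariski_closed [set x : 'rV[K]_n | f.@[x 0] = 0].
Proof.
exists [set f]; apply/seteqP; split => x /= fx; first by move=> _ ->.
exact: fx.
Qed.

(** * The singularity of two crossing axes *)

(** An equation of F that is not identically zero on the axis has the form
t^m h(t) there, with h(0) <> 0.  So F is covered by t = 0 and h = 0; being
irreducible, F lies in one of them, and the origin rules out the second. *)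
Lemma proper_irreducible_subset_axis k F G : irreducible_closed F ->
  G `<=` axis k -> F `<` G -> F 0 -> F `<=` [set 0].
Proof.
move=> [[S FE] _ irrF] Gk [FG GF] F0.
have [z [Gz Fz]] : exists z, G z /\ ~ F z.
  apply: contrapT => noz; apply: GF => z Gz.
  by apply: contrapT => Fz; apply: noz; exists z.
have [f Sf fz] : exists2 f, S f & f.@[z 0] <> 0.
  apply: contrapT => nof; apply: Fz; rewrite FE => f Sf.
  by apply: contrapT => fz; apply: nof; exists f.
have f0 x : F x -> f.@[x 0] = 0 by rewrite FE => /(_ f Sf).
have [m [h /implyP h0 fE]] := multiplicity_XsubC (axis_restr k f) 0.
have {}h0 : ~~ root h 0.
  apply: h0; apply: contra_notN fz => /eqP fr0.
  by rewrite -(horner_axis_restr _ (Gk _ Gz)) fr0 horner0.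
have [| Fk | Fh] := irrF _ _ (zariski_closed_zeros 'X_k)
                             (zariski_closed_zeros (mpoly_of_poly k h)).
- move=> x Fx; have := f0 _ Fx.
  rewrite -(horner_axis_restr _ (Gk _ (FG _ Fx))) fE hornerM horner_exp.
  rewrite hornerXsubC subr0 => /eqP; rewrite mulf_eq0 => /orP [/eqP hx|].
    by right => /=; rewrite meval_mpoly_of_poly.
  by rewrite expf_eq0 => /andP [_ /eqP xk]; left => /=; rewrite mevalXU.
- move=> x Fx; apply/rowP => l; rewrite mxE.
  have [->|lk] := eqVneq l k; last exact: Gk (FG _ Fx) _ lk.
  by have := Fk _ Fx; rewrite /= mevalXU.
- have := Fh _ F0; rewrite /= meval_mpoly_of_poly mxE => h00.
  by rewrite /root h00 eqxx in h0.
Qed.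

(** The tangent space at the origin has dimension 2.  In a chain
F 0 < F 1 < F 2 of irreducible closed sets through the origin, F 2 lies on an
axis, F 1 is then reduced to the origin, and nothing is left for F 0. *)
Lemma cross_not_smooth (i j : 'I_n) : i != j ->
  (forall k, k = i \/ k = j) ->
  ~ smooth_at [set x : 'rV[K]_n | x 0 i * x 0 j = 0] 0.
Proof.
move=> ij ij_all [T [TE [chainT _]]].
set Z := [set x | _] in TE chainT.
have axisZ k : axis k `<=` Z.
  move=> x xk; rewrite /Z /=; have [|] := ij_all k => E; rewrite E in xk.
    by rewrite (xk j) ?mulr0 // eq_sym.
  by rewrite (xk i) ?mul0r.
have T_full : T = fullv.
  apply/vspaceP => v; rewrite memvf; apply/TE => f fZ.
  rewrite big1 // => k _; rewrite pderiv_eq0 ?mul0r // => x xk.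
  exact/fZ/axisZ/xk.
have T2 : (2 <= \dim T)%N.
  rewrite T_full dimvf /dim /= mul1n -[n]card_ord -cardsT.
  rewrite -(_ : #|[set i; j]%SET| = 2%N); last by rewrite cards2 ij.
  exact/subset_leq_card/finset.subsetT.
have [F [Firr Flt]] := chainT.
have [irr0 F00 _] := Firr 0 (leq0n _).
have [irr1 F10 _] := Firr 1 (ltnW T2).
have [irr2 _ F2Z] := Firr 2 T2.
have [k F2k] : exists k, F 2 `<=` axis k.
  have [_ _ irrF] := irr2.
  have [|Fi|Fj] := irrF _ _ (zariski_closed_zeros 'X_i)
                            (zariski_closed_zeros 'X_j).
  - move=> x /F2Z /= /eqP; rewrite mulf_eq0 => /orP [] /eqP x0.
      by left; rewrite /= mevalXU.
    by right; rewrite /= mevalXU.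
  - exists j => x /Fi /=; rewrite mevalXU => xi l.
    by have [->|->] := ij_all l; rewrite ?eqxx.
  - exists i => x /Fj /=; rewrite mevalXU => xj l.
    by have [->|->] := ij_all l; rewrite ?eqxx.
have F1_0 := proper_irreducible_subset_axis irr1 F2k (Flt 1 T2) F10.
have [_] := Flt 0 (ltnW T2); apply=> x /F1_0 ->; exact: F00.
Qed.
End CoordinateAxis.

(** * A quiver Grassmannian with a node *)

Lemma ord_uniq m (i j : 'I_m) : m = 1%N -> i = j.
Proof. by move=> m1; subst m; rewrite !ord1. Qed.

Lemma enum_ord_single m (i : 'I_m) : m = 1%N -> enum 'I_m = [:: i].
Proof.
move=> m1; subst m.
rewrite enum_ordSl (size0nil (s := enum 'I_0)) ?size_enum_ord //=.
by rewrite !ord1.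
Qed.

Section NilpotentArrow.
Variables (K : numFieldType) (Q : quiver) (a : arrow Q).
Hypothesis a_neq : src a != tgt a.

Let ends := [:: src a; tgt a].

(** Row vectors are multiplied on the right, so this is the map that kills the
first basis vector and sends the second one to it. *)
Definition nilmx : 'M[K]_2 := delta_mx 1 0.

Definition nilpotent_rep : representation K Q :=
  @Representation K Q (fun=> 'rV[K]_2)
    (fun b => if b == a then linfun (mulmxr nilmx) else 0).

Definition end_dim (v : vertex Q) : nat := v \in ends.

Let X := nilpotent_rep.
Let e := end_dim.
Let stdbasis : seq 'rV[K]_2 := [:: 'e_0; 'e_1].

Lemma stdbasis_free : free stdbasis.
Proof.
rewrite /stdbasis free_cons seq1_free span_seq1; apply/andP; split; last first.
  by apply/eqP => /rowP /(_ 1) /eqP; rewrite !mxE !eqxx oner_eq0.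
apply/vlineP => -[k /rowP /(_ 0) /eqP].
by rewrite !mxE !eqxx mulr0 oner_eq0.
Qed.

Lemma codimvE v : codimv X e v = (2 - end_dim v)%N.
Proof. by rewrite /codimv dimvf /dim /= mul1n. Qed.

Lemma size_end_sub v : size (take (end_dim v) stdbasis) == end_dim v.
Proof. by rewrite /end_dim; case: (v \in ends). Qed.

Lemma size_end_compl v : size (drop (end_dim v) stdbasis) == codimv X e v.
Proof. by rewrite codimvE size_drop. Qed.

Lemma end_chart_free v :
  free (Tuple (size_end_sub v) ++ Tuple (size_end_compl v)).
Proof. by rewrite /= cat_take_drop stdbasis_free. Qed.

(** The chart centred at the subrepresentation spanned by the first basis vector
at both ends of the arrow.  Cutting the basis after [end_dim v] vectors treats
the ends and the other vertices, which have no chosen vector, uniformly. *)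
Definition end_chart : chart X e :=
  @Chart K Q X e (fun v => Tuple (size_end_sub v))
    (fun v => Tuple (size_end_compl v)) end_chart_free.

Let c := end_chart.

Lemma end_dim1 v : v \in ends -> end_dim v = 1%N.
Proof. by rewrite /end_dim => ->. Qed.

Lemma end_codim1 v : v \in ends -> codimv X e v = 1%N.
Proof. by rewrite codimvE => /end_dim1 ->. Qed.

Lemma end_dim_gt0 v : v \in ends -> (0 < end_dim v)%N.
Proof. by move/end_dim1->. Qed.

Lemma end_codim_gt0 v : v \in ends -> (0 < codimv X e v)%N.
Proof. by move/end_codim1->. Qed.

(** The coordinate whose value s describes the line of e_0 + s e_1 at v. *)
Definition end_coord v (hv : v \in ends) : 'I_#|coords X e| :=
  enum_rank (Tagged (coord_idx X e)
    (Ordinal (end_dim_gt0 hv), Ordinal (end_codim_gt0 hv)) : coords X e).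

Lemma chart_vector_end y v (hv : v \in ends) i :
  @chart_vector K Q X e c y v i = 'e_0 + y 0 (end_coord hv) *: 'e_1 :> 'rV[K]_2.
Proof.
rewrite (ord_uniq i (Ordinal (end_dim_gt0 hv)) (end_dim1 hv)).
rewrite /chart_vector (bigD1 (Ordinal (end_codim_gt0 hv))) //=.
rewrite big1 ?addr0; last first.
  by move=> j /eqP []; apply: (ord_uniq _ _ (end_codim1 hv)).
rewrite (tnth_nth (0 : 'rV[K]_2)) (tnth_nth (0 : 'rV[K]_2)) /=.
by rewrite -/(end_coord hv) (end_dim1 hv).
Qed.

Lemma chart_point_end y v (hv : v \in ends) :
  chart_point c y v = <[('e_0 + y 0 (end_coord hv) *: 'e_1)%R]>%VS
    :> {vspace 'rV[K]_2}.
Proof.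
rewrite /chart_point /image_mem.
rewrite (enum_ord_single (Ordinal (end_dim_gt0 hv)) (end_dim1 hv)).
by rewrite /= span_seq1 (chart_vector_end _ hv).
Qed.

Lemma chart_point_off y v : v \notin ends -> chart_point c y v = 0%VS.
Proof.
move=> hv; rewrite /chart_point /image_mem.
rewrite (size0nil (s := enum _)) ?span_nil // size_enum_ord.
by rewrite /e /end_dim (negPf hv).
Qed.

Lemma mem_src : src a \in ends. Proof. exact: mem_head. Qed.
Lemma mem_tgt : tgt a \in ends. Proof. by rewrite inE mem_head orbT. Qed.

Lemma dim_chart_point y v : \dim (chart_point c y v) = e v.
Proof.
rewrite /e /end_dim; have [hv|hv] := boolP (v \in ends); last first.
  by rewrite chart_point_off ?dimv0.
rewrite (chart_point_end y hv) dim_vline; case: eqP => // /rowP /(_ 0) /eqP.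
by rewrite !mxE !eqxx mulr0 addr0 oner_eq0.
Qed.

(** The line e_0 + s e_1 is mapped to s e_0, and e_0 spans the line of
e_0 + t e_1 only for t = 0. *)
Lemma nilpotent_line (s t : K) :
  (linfun (mulmxr nilmx) @: <[('e_0 + s *: 'e_1)%R : 'rV[K]_2]> <=
     <[('e_0 + t *: 'e_1)%R]>)%VS <-> s * t = 0.
Proof.
rewrite limg_line lfunE /= mulmxDl -scalemxAl -rowE -rowE.
have -> : row 0 nilmx + s *: row 1 nilmx = s *: 'e_0.
  by apply/rowP => l; rewrite !mxE /= add0r.
rewrite -memvE; split.
  case/vlineP => k /rowP E; have /eqP := E 0; have /eqP := E 1.
  rewrite !mxE !eqxx /= !mulr0 !mulr1 add0r addr0 => /eqP kt /eqP ->.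
  by rewrite mulr1 -kt.
move/eqP; rewrite mulf_eq0 => /orP[] /eqP ->; first by rewrite scale0r mem0v.
by rewrite scale0r addr0 memvZ ?memv_line.
Qed.

Lemma in_end_chart : in_chart c =
  [set y | y 0 (end_coord mem_src) * y 0 (end_coord mem_tgt) = 0].
Proof.
apply/seteqP; split => y /=.
  case=> _ /(_ a).
  rewrite (chart_point_end y mem_src) (chart_point_end y mem_tgt).
  by rewrite /= eqxx => /nilpotent_line.
move=> y0; split=> [v|b]; first exact: dim_chart_point.
have [->|ba] := eqVneq b a; last by rewrite /= (negPf ba) lim0g sub0v.
rewrite (chart_point_end y mem_src) (chart_point_end y mem_tgt) /= eqxx.
exact/nilpotent_line.
Qed.

(** Away from the ends the subspace is zero and has no parameter. *)
Lemma end_coordP k : k = end_coord mem_src \/ k = end_coord mem_tgt.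
Proof.
rewrite -(enum_valK k); case: (enum_val k) => v [i j].
have hv : v \in ends.
  by apply: contraT => hv; case: i => m; rewrite /e /end_dim (negPf hv).
have -> : enum_rank (existT _ v (i, j) : coords X e) = end_coord hv.
  congr enum_rank; congr existT; congr (_, _).
    exact: (ord_uniq _ _ (end_dim1 hv)).
  exact: (ord_uniq _ _ (end_codim1 hv)).
have := hv; rewrite !inE => /orP[] /eqP E; subst v; [left | right];
  by congr end_coord; apply: bool_irrelevance.
Qed.

Lemma end_coord_neq : end_coord mem_src != end_coord mem_tgt.
Proof.
apply: contra a_neq => /eqP /enum_rank_inj /(congr1 tag) /= ->.
exact: eqxx.
Qed.

Lemma nilpotent_rep_singular : singular_grassmannian X e.
Proof.
exists c, 0; rewrite in_end_chart; split; first by rewrite /= mxE mul0r.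
exact: cross_not_smooth end_coord_neq end_coordP.
Qed.

End NilpotentArrow.

(** * Wild acyclic quivers *)

Lemma acyclic_src_neq_tgt (Q : quiver) (a : arrow Q) :
  acyclic Q -> src a != tgt a.
Proof.
move=> acQ; apply: contraT; rewrite negbK => /eqP loop_a.
suff /acQ : cycle (@adj Q) [:: src a] by [].
by rewrite /= andbT; apply/existsP; exists a; rewrite -loop_a eqxx.
Qed.

(** Without arrows, the component of every vertex is the Dynkin diagram A_1. *)
Lemma wild_arrow (Q : quiver) : wild Q -> exists a : arrow Q, True.
Proof.
move=> [p wildp]; apply: contrapT => noarrow.
have [] // := wildp 1%N (path_edges 0); last first.
  by move/(_ (@DynkinA 1 (leqnn 1))).
exists (fun=> p); split.
- by move=> i j _; rewrite !ord1.
- apply/setP => q; rewrite !inE; apply/idP/imsetP.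
    case/connectP => -[|r s] /=; first by exists ord0.
    by case/andP => /orP[] /existsP [a]; case: noarrow; exists a.
  by case=> _ _ ->; exact: connect0.
- move=> i j; apply/eqP; rewrite cards_eq0; apply/eqP/setP => a.
  by case: noarrow; exists a.
Qed.

Theorem corollary3p6 (R : realType) (Q : quiver) :
  acyclic Q -> wild Q ->
  exists (X : representation (complex R) Q) (e : vertex Q -> nat),
    singular_grassmannian X e.
Proof.
move=> acQ /wild_arrow [a _].
exists (@nilpotent_rep _ Q a), (@end_dim Q a).
exact/nilpotent_rep_singular/acyclic_src_neq_tgt.
Qed.
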